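(* Let $B=(V,E)$ be a finite bipartite multigraph with at least one edge, and let $t\colon V\to\mathbb{N}$ be a function that takes the constant value $t_1$ on one block and the constant value $t_2$ on the other block of the bipartition of $B$. Then $$\chi_{\mathrm{OL}}^t(B)\,=\,\chi^t(B)\,=\,\chi'(B)+t_1+t_2\,=\,\Delta(B)+t_1+t_2.$$
   Context: $\mathbb{N}=\{0,1,2,\dots\}$, $\mathbb{Z}^+=\{1,2,\dots\}$, and $\mathcal{P}(\mathbb{Z}^+)$ is the power set of $\mathbb{Z}^+$. A multigraph $G=(V,E)$ may have several parallel edges between two vertices, but every edge $uv=\{u,v\}$ has two distinct ends. The blocks of a bipartition are its two vertex classes (every edge has one end in each). $\Delta(G)$ is the maximal degree (edges counted with multiplicity). An edge coloring is a map $c'\colon E\to\{1,\dots,m\}$ with $c'(e)\neq c'(f)$ for any two distinct edges $e,f$ sharing at least one end; $\chi'(G)$ (chromatic index) is the smallest $m\in\mathbb{Z}^+$ for which such a map exists. Pre-fixed version: for a multi-labeling $c\colon V\to\mathcal{P}(\mathbb{Z}^+)$, an edge coloring $c'$ avoids $c$ if $c'(e)\notin\bigcup_{v\in e}c(v)$ for every $e\in E$. $\chi'_c(G)$ is the smallest $m\in\mathbb{Z}^+$ for which there is an edge coloring $c'\colon E\to\{1,\dots,m\}$ that avoids $c$. A $t$-labeling is a multi-labeling $c$ with $|c(v)|\le t(v)$ for all $v\in V$. The $t$-avoiding chromatic index is $\chi^t(G):=\max\{\chi'_c(G) : c \text{ is a } t\text{-labeling}\}$. On-line version: for $t\colon V\to\mathbb{N}$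 let $\operatorname{supp}(t)=\{v\in V : t(v)\neq0\}$; for $U\subseteq V$ let $\mathsf{1}_U\colon V\to\{0,1\}$ be the indicator function of $U$. A set of edges is independent if its members are pairwise disjoint (no two share an end). $G-U$ is obtained by deleting the vertices in $U$ and all edges incident with them; $G-F$ by deleting the edges in $F$. For $m\in\mathbb{N}$, being on-line $t$-avoiding edge $m$-colorable is defined recursively: (i) if $m=0$, then $G$ is on-line $t$-avoiding edge $m$-colorable if $E=\emptyset$; (ii) if $m>0$, then $G$ is on-line $t$-avoiding edge $m$-colorable if for every subset $U\subseteq\operatorname{supp}(t)$ there exists an independent subset $F\subseteq E(G-U)$ such that $G-F$ is on-line $(t-\mathsf{1}_U)$-avoiding edge $(m-1)$-colorable. The on-line $t$-avoiding chromatic index $\chi_{\mathrm{OL}}^t(G)$ is the smallest $m\in\mathbb{N}$ such that $G$ is on-line $t$-avoiding edge $m$-colorable. *)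

(* Defs.v *)
From mathcomp Require Import all_boot all_order.
From mathcomp Require Import boolp classical_sets functions cardinality.

Set Implicit Arguments.
Unset Strict Implicit.
Unset Printing Implicit Defensive.

(* Least and greatest element of a set of naturals.  They are 0 when there is
   no such element; this is never the case for the sets used below as long as
   the labelings involved are finite. *)
Definition nat_min (A : set nat) : nat := xget 0 (A `&` lbound A)%classic.
Definition nat_max (A : set nat) : nat := xget 0 (A `&` ubound A)%classic.

(* Multigraphs with vertex set V, whose edges form a subset of a finite carrier
   K, so that deleting edges does not change the types.  Parallel edges are
   distinct elements of K with the same set of ends. *)
Record multigraph (V K : finType) := Multigraph {
  edges : {set K};
  ends : K -> {set V};
  card_ends : forall e, e \in edges -> #|ends e| = 2
}.

Section Multigraph.
Variables V K : finType.
Implicit Types (G : multigraph V K) (X U : {set V}) (F : {set K}).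

Definition bipartition G X : Prop :=
  forall e, e \in edges G ->
    #|ends G e :&: X| = 1 /\ #|ends G e :&: ~: X| = 1.

Definition degree G (v : V) : nat :=
  #|[set e in edges G | v \in ends G e]%SET|.

Definition max_degree G : nat := \max_(v : V) degree G v.

(* The values of [c'] outside [edges G] are irrelevant. *)
Definition edge_coloring G (m : nat) (c' : K -> nat) : Prop :=
  (forall e, e \in edges G -> 1 <= c' e <= m) /\
  (forall e f, e \in edges G -> f \in edges G -> e <> f ->
     ~~ [disjoint ends G e & ends G f] -> c' e <> c' f).

Definition chromatic_index G : nat :=
  nat_min [set m | 0 < m /\ exists c', edge_coloring G m c']%classic.

Definition multilabeling (c : V -> set nat) : Prop :=
  forall v, (c v `<=` [set k | 0 < k])%classic.

Definition avoids G (c : V -> set nat) (c' : K -> nat) : Prop :=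
  forall e, e \in edges G ->
    ~ (\bigcup_(v in [set` ends G e]) c v)%classic (c' e).

Definition chromatic_index_avoiding G (c : V -> set nat) : nat :=
  nat_min [set m | 0 < m /\
    exists c', edge_coloring G m c' /\ avoids G c c']%classic.

Definition t_labeling (t : V -> nat) (c : V -> set nat) : Prop :=
  multilabeling c /\ forall v, (c v #<= `I_(t v))%card.

Definition t_avoiding_index G (t : V -> nat) : nat :=
  nat_max [set chromatic_index_avoiding G c | c in t_labeling t]%classic.

Definition supp (t : V -> nat) : {set V} := [set v | t v != 0]%SET.

Definition independent G F : Prop :=
  forall e f, e \in F -> f \in F -> e <> f -> [disjoint ends G e & ends G f].

Definition edges_del_vertices G U : {set K} :=
  [set e in edges G | [disjoint ends G e & U]]%SET.

Lemma card_ends_del_edges G F e :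
  e \in edges G :\: F -> #|ends G e| = 2.
Proof. by rewrite inE => /andP[_ /card_ends]. Qed.

Definition del_edges G F : multigraph V K :=
  Multigraph (@card_ends_del_edges G F).

Fixpoint online_colorable (m : nat) (t : V -> nat) G : Prop :=
  if m is m'.+1 then
    forall U, U \subset supp t ->
      exists F, [/\ F \subset edges_del_vertices G U, independent G F &
        online_colorable m' (fun v => t v - (v \in U)) (del_edges G F)]
  else #|edges G| = 0.

Definition online_t_avoiding_index G (t : V -> nat) : nat :=
  nat_min [set m | online_colorable m t G]%classic.

End Multigraph.

(* Main.v *)
(* Upper bounds (Galvin, Schauz).  By König's theorem the edges have a proper
   colouring with D = Delta(B) colours.  Orient the line graph so that at the
   vertices of one block edges point to larger colours, and at the vertices of
   the other block to smaller ones; every out-degree is then less than D.  In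
   each round let F be a kernel of the edges that avoid U.  An edge that
   survives either meets U, which happens at most t1 + t2 times, or loses an
   out-neighbour, so D + t1 + t2 rounds suffice.  Playing against the sets
   U_k = {v | k in c(v)} turns such a strategy into a colouring avoiding c.
   Lower bounds: take c(v) = {1, ..., t1} on one block and
   c(v) = {t1 + 1, ..., t1 + t2} on the other; the colours 1, ..., t1 + t2 are
   then unusable, and a vertex of maximal degree needs D further ones. *)

Require Import Defs.
From mathcomp Require Import all_boot all_order.
From mathcomp Require Import boolp classical_sets functions cardinality.
From mathcomp Require Import fintype finset.

Set Implicit Arguments.
Unset Strict Implicit.
Unset Printing Implicit Defensive.

(** * Extrema of sets of naturals and counting of colours *)

Lemma nat_minP (A : set nat) m :
  A m -> (forall k, A k -> m <= k) -> nat_min A = m.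
Proof.
move=> Am lb; apply: xget_unique; first by split => // k /lb.
move=> k [Ak lbk]; apply/eqP; rewrite eqn_leq lb // andbT.
exact: lbk.
Qed.

Lemma nat_maxP (A : set nat) m :
  A m -> (forall k, A k -> k <= m) -> nat_max A = m.
Proof.
move=> Am ub; apply: xget_unique; first by split => // k /ub.
move=> k [Ak ubk]; apply/eqP; rewrite eqn_leq ub //=.
exact: ubk.
Qed.

Lemma nat_min_le (A : set nat) m : A m -> nat_min A <= m.
Proof.
move=> Am; have /asboolP exA : `[< A m >] by apply/asboolP.
have exP : exists k, `[< A k >] by exists m; apply/asboolP.
case: (ex_minnP exP) => k /asboolP Ak minA.
rewrite (@nat_minP A k) //; first by apply: minA; apply/asboolP.
by move=> j Aj; apply: minA; apply/asboolP.
Qed.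

Lemma card_colors (K : finType) (A : {set K}) (c : K -> nat) p n :
  {in A &, injective c} -> {in A, forall e, p < c e <= p + n} -> #|A| <= n.
Proof.
move=> inj_c c_in; rewrite cardE -(size_map c) -[leqRHS](size_iota p.+1).
apply: uniq_leq_size => [|k /mapP[e eA ->]].
  rewrite map_inj_in_uniq ?enum_uniq // => e f.
  by rewrite !mem_enum; apply: inj_c.
by rewrite mem_iota addSn ltnS c_in // -mem_enum.
Qed.

Lemma missing_color (K : finType) (A : {set K}) (c : K -> nat) n :
  #|A| < n -> exists2 a, 0 < a <= n & {in A, forall e, c e != a}.
Proof.
move=> ltAn.
have /allPn[a a_in a_notin] : ~~ all (mem (map c (enum A))) (iota 1 n).
  apply/negP => /allP sub.
  have := uniq_leq_size (iota_uniq 1 n) sub.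
  by rewrite size_iota size_map -cardE leqNgt ltAn.
exists a; first by move: a_in; rewrite mem_iota add1n ltnS.
move=> e eA; apply: contraNneq a_notin => <-.
by apply: map_f; rewrite mem_enum.
Qed.

(** An injection of [A] into [I_n] sends the selected members of [s] to distinct numbers below [n].
    This turns the bound on a label set into a bound on the number of rounds whose colour it
    contains. *)
Lemma card_le_count (A : set nat) n s :
  (A #<= `I_n)%card -> uniq s -> count (fun j => `[< A j >]) s <= n.
Proof.
move=> /pcard_leP/injfunPex[f f_in f_inj] s_uniq; rewrite -size_filter.
have in_A j : j \in [seq i <- s | `[< A i >]] -> A j.
  by rewrite mem_filter => /andP[/asboolP].
rewrite -(size_map f) -[leqRHS](size_iota 0); apply: uniq_leq_size.
  rewrite map_inj_in_uniq ?filter_uniq // => i j /in_A Ai /in_A Aj.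
  by apply: f_inj; apply: mem_set.
by move=> _ /mapP[j /in_A/f_in fj ->]; rewrite mem_iota.
Qed.

(** * Galvin's kernels and König's colouring for edges with a left and a right end *)

Section TwoSided.
Variables (K : finType) (L R : eqType) (l : K -> L) (r : K -> R).

Definition proper_on (c : K -> nat) (S : {set K}) :=
  {in S &, forall e f, e <> f -> l e = l f \/ r e = r f -> c e <> c f}.

(** Galvin's orientation of the line graph; parallel edges of different colours are joined by arcs
    in both directions. *)
Definition out_nbrs (c : K -> nat) (S : {set K}) (e : K) :=
  [set f in S | (l f == l e) && (c e < c f) || (r f == r e) && (c f < c e)].

Lemma proper_onS (c : K -> nat) (S T : {set K}) :
  T \subset S -> proper_on c S -> proper_on c T.
Proof. by move=> /subsetP sTS cS e f /sTS eS /sTS fS; apply: cS. Qed.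

Lemma out_nbrsS (c : K -> nat) (S T : {set K}) e :
  T \subset S -> out_nbrs c T e \subset out_nbrs c S e.
Proof.
move=> /subsetP sTS; apply/subsetP => f; rewrite !inE => /andP[/sTS -> ->].
by [].
Qed.

Lemma proper_on_inj (c : K -> nat) (S : {set K}) : proper_on c S ->
  {in S &, forall e f, l e = l f \/ r e = r f -> c e = c f -> e = f}.
Proof.
by move=> cS e f eS fS ef ceq; apply: contrapT => neq; apply: (cS e f).
Qed.

(** At the left end only the [n - c e] colours above [c e] can occur, at the right end only the
    [c e - 1] positive colours below it. *)
Lemma card_out_nbrs (c : K -> nat) (S : {set K}) n e :
  proper_on c S -> {in S, forall f, 0 < c f <= n} -> e \in S ->
  #|out_nbrs c S e| < n.
Proof.
move=> cS c_in eS; have /andP[ce_gt0 ce_le] := c_in e eS.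
pose Lset := [set f in S | (l f == l e) && (c e < c f)].
pose Rset := [set f in S | (r f == r e) && (c f < c e)].
have -> : out_nbrs c S e = Lset :|: Rset.
  by apply/setP => f; rewrite !inE andb_orr.
have leL : #|Lset| <= n - c e.
  apply: (@card_colors _ _ c (c e)) => [f g|f]; rewrite !inE.
    move=> /and3P[fS /eqP lf _] /and3P[gS /eqP lg _].
    by apply: (proper_on_inj cS); rewrite // lf; left.
  by move=> /and3P[fS _ ->]; rewrite subnKC //; case/andP: (c_in f fS).
have leR : #|Rset| <= (c e).-1.
  apply: (@card_colors _ _ c 0) => [f g|f]; rewrite !inE.
    move=> /and3P[fS /eqP rf _] /and3P[gS /eqP rg _].
    by apply: (proper_on_inj cS); rewrite // rf; right.
  move=> /and3P[fS _ lt_c]; have /andP[-> _] := c_in f fS.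
  by rewrite add0n /= -ltnS prednK.
apply: leq_ltn_trans (leq_card_setU Lset Rset) _.
apply: leq_ltn_trans (leq_add leL leR) _.
by rewrite -addnS prednK // subnK.
Qed.

(* If the edges of largest colour at their left ends do not form a matching,
   then one of them, [e], meets another one, [f], of smaller colour at a right
   end.  A kernel of [S :\ e] also absorbs [e]: it contains [f], or it absorbs
   [f], which is only possible at the right end. *)
Lemma kernel_exists (c : K -> nat) (S : {set K}) : proper_on c S ->
  exists F : {set K}, [/\ F \subset S,
    {in F &, forall e f, e <> f -> l e <> l f /\ r e <> r f} &
    {in S, forall e, e \notin F -> exists2 f, f \in F & f \in out_nbrs c S e}].
Proof.
have [n] := ubnP #|S|; elim: n S => // n IHn S ltSn cS.
pose best := [set e in S | [forall f in S, (l f == l e) ==> (c f <= c e)]].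
have bestP e f : e \in best -> f \in S -> l f = l e -> c f <= c e.
  rewrite inE => /andP[_ /forall_inP/(_ f) + fS lfe] => /(_ fS).
  by rewrite lfe eqxx.
have best_sub e : e \in best -> e \in S by rewrite inE => /andP[].
have [/exists_inP[e eb /exists_inP[f fb /andP[/eqP rfe ltfe]]]|no_conflict] :=
  boolP [exists e in best, exists f in best, (r f == r e) && (c f < c e)].
  have [||F [sF indepF absF]] := IHn (S :\ e).
  - by rewrite [#|S|](cardsD1 e) best_sub in ltSn.
  - exact/proper_onS/cS/subsetDl.
  exists F; split => //; first exact/(subset_trans sF)/subsetDl.
  move=> g gS gF; have [geq|neq_ge] := eqVneq g e; last first.
    have [|h hF hg] := absF g _ gF; first by rewrite !inE neq_ge.
    by exists h => //; apply: subsetP hg; apply/out_nbrsS/subsetDl.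
  rewrite {g gS gF}geq; have [fF|fF] := boolP (f \in F).
    by exists f; rewrite // inE best_sub // rfe eqxx ltfe orbT.
  have neq_fe : f != e by apply: contraTneq ltfe => ->; rewrite ltnn.
  have [|h hF] := absF f _ fF; first by rewrite !inE neq_fe best_sub.
  rewrite !inE => /andP[/andP[_ hS] /orP[|]] /andP[/eqP eq_end lt_c].
    by have := bestP _ _ fb hS eq_end; rewrite leqNgt lt_c.
  by exists h; rewrite // inE hS eq_end rfe eqxx (ltn_trans lt_c ltfe) orbT.
have conflictF e f : e \in best -> f \in best -> r f = r e -> c e <= c f.
  move=> eb fb rfe; rewrite leqNgt; apply: contra no_conflict => ltfe.
  apply/exists_inP; exists e => //; apply/exists_inP.
  by exists f; rewrite // rfe eqxx.
exists best; split; first exact/subsetP/best_sub.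
  move=> e f eb fb neq_ef.
  have neq_c := cS _ _ (best_sub _ eb) (best_sub _ fb) neq_ef.
  split=> eq_end.
    by apply: neq_c; [left | apply/eqP; rewrite eqn_leq !bestP ?best_sub].
  by apply: neq_c; [right | apply/eqP; rewrite eqn_leq !conflictF].
(* Without conflicts, an edge outside [best] is absorbed by the edge of largest colour at its left
   end. *)
move=> e eS e_best.
have [|f /andP[fS /eqP lfe] maxf] :=
    @arg_maxnP _ e [pred f | (f \in S) && (l f == l e)] c.
  by rewrite /= eS eqxx.
have fb : f \in best.
  rewrite inE fS; apply/forall_inP => g gS; apply/implyP => /eqP lgf.
  by apply: maxf; rewrite /= gS lgf lfe eqxx.
exists f => //; rewrite inE fS lfe eqxx ltn_neqAle (bestP f e) // andbT.
apply/orP; left; apply/eqP; apply: cS => //; last by left.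
by move=> eqef; rewrite eqef fb in e_best.
Qed.

(* The edges at which the colours [a] and [b] are exchanged to free [a] at the
   right vertex [y], where [b] is missing.  As the walk enters left vertices
   only along [a], it never reaches one where [a] is missing. *)
Inductive alternating (c : K -> nat) (S : {set K}) a b y : K -> Prop :=
| alternating_start e : e \in S -> r e = y -> c e = a -> alternating c S a b y e
| alternating_left e f : alternating c S a b y e -> c e = a ->
    f \in S -> l f = l e -> c f = b -> alternating c S a b y f
| alternating_right e f : alternating c S a b y e -> c e = b ->
    f \in S -> r f = r e -> c f = a -> alternating c S a b y f.

(** A Kempe exchange: swapping [a] and [b] along the chain that starts at [r e0] frees [a] at both
    ends of [e0], which then receives it. *)
Lemma proper_extend (c : K -> nat) (S : {set K}) e0 a b n :
  proper_on c S -> {in S, forall e, 0 < c e <= n} -> e0 \notin S ->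
  0 < a <= n -> {in S, forall e, l e = l e0 -> c e <> a} ->
  0 < b <= n -> {in S, forall e, r e = r e0 -> c e <> b} ->
  exists c', proper_on c' (e0 |: S) /\ {in e0 |: S, forall e, 0 < c' e <= n}.
Proof.
move=> cS c_in e0S a_in a_free b_in b_free.
pose C e := `[< alternating c S a b (r e0) e >].
have CS e : C e -> e \in S by move=> /asboolP[].
have C_a e : e \in S -> r e = r e0 -> c e = a -> C e.
  by move=> *; apply/asboolP/alternating_start.
have C_ab e f : C e -> c e = a -> f \in S -> l f = l e -> c f = b -> C f.
  by move=> /asboolP Ce *; apply/asboolP/(alternating_left Ce).
have C_ba e f : C e -> c e = b -> f \in S -> r f = r e -> c f = a -> C f.
  by move=> /asboolP Ce *; apply/asboolP/(alternating_right Ce).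
have CE e : C e ->
    c e = a /\ (r e = r e0 \/ exists g, [/\ C g, c g = b & r e = r g]) \/
    c e = b /\ (exists g, [/\ C g, c g = a & l e = l g]).
  move=> /asboolP[g _ ? ?|g h /asboolP Cg ? _ ? ?|g h /asboolP Cg ? _ ? ?].
  - by left; split; [|left].
  - by right; split=> //; exists g.
  - by left; split=> //; right; exists g.
have eq_edge := proper_on_inj cS.
(* The chain is closed under passing to an adjacent edge of the other colour. At the end where the
   walk leaves [e] this is the definition; at the end where it entered, that edge can only be the
   predecessor, and at the start [b_free] excludes it. *)
have C_adj e f : C e -> f \in S -> l e = l f \/ r e = r f ->
    c e = a /\ c f = b \/ c e = b /\ c f = a -> C f.
  move=> Ce fS ef; have [ceq _|cneq] := eqVneq (c e) (c f).
    by rewrite -(eq_edge e f) // CS.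
  case=> [] [cea cfb]; case: ef => end_ef.
  - exact: C_ab Ce _ _ _ _.
  - case: (CE e Ce) => [[_ [re0|[g [Cg cg reg]]]]|[ceb _]].
    + by case: (b_free f) => //; rewrite -end_ef.
    + by rewrite -(@eq_edge g f (CS g Cg)) ?cg -?reg; auto.
    + by rewrite ceb cfb eqxx in cneq.
  - case: (CE e Ce) => [[cea' _]|[_ [g [Cg cg leg]]]].
      by rewrite cea' cfb eqxx in cneq.
    by rewrite -(@eq_edge g f (CS g Cg)) ?cg -?leg; auto.
  - exact: C_ba Ce _ _ _ _.
pose c1 e := if C e then if c e == a then b else a else c e.
have c1C e : C e -> c e = a /\ c1 e = b \/ c e = b /\ c1 e = a.
  rewrite /c1 => Ce; rewrite Ce.
  have [cea|cna] := eqVneq; first by left.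
  by case: (CE e Ce) => [[/eqP]|[]]; [rewrite (negbTE cna) | right].
have c1N e : ~~ C e -> c1 e = c e by rewrite /c1 => /negbTE->.
have c1S : proper_on c1 S.
  have mixed e f : C e -> ~~ C f -> f \in S -> l e = l f \/ r e = r f ->
      c1 e <> c1 f.
    move=> Ce Cf fS ef; rewrite (c1N f) // => eq1; move/negP: Cf; apply.
    apply: (C_adj e) => //; rewrite -eq1.
    by case: (c1C e Ce) => [] [-> ->]; auto.
  move=> e f eS fS neq_ef ef.
  have [Ce|Ce] := boolP (C e); have [Cf|Cf] := boolP (C f).
  - move=> eq1; apply: (cS e f) => //; move: eq1.
    by case: (c1C e Ce) => [] [-> ->]; case: (c1C f Cf) => [] [-> ->].
  - exact: mixed.
  - by apply/nesym/mixed => //; case: ef => ->; auto.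
  - by rewrite !c1N //; apply: cS.
have c1_in e : e \in S -> 0 < c1 e <= n.
  move=> eS; have [Ce|Ce] := boolP (C e); last by rewrite c1N // c_in.
  by case: (c1C e Ce) => [] [_ ->].
(* An edge recoloured from [b] to [a] cannot lie at [r e0], where [b] is missing, nor at [l e0],
   which the chain could enter only along the missing colour [a]. *)
have c1_free e : e \in S -> l e = l e0 \/ r e = r e0 -> c1 e <> a.
  move=> eS ee0; have [Ce|Ce] := boolP (C e).
    case: (c1C e Ce) => [] [ce ->].
      (* The colours may coincide; then [a] is missing at both ends of [e0] from the outset. *)
      move=> eqba; case: ee0 => ee0; first exact: (a_free e).
      by apply: (b_free e); rewrite // eqba.
    move=> _; case: ee0 => ee0; last exact: (b_free e).
    case: (CE e Ce) => [[cea _]|[_ [g [Cg cg leg]]]]; first exact: (a_free e).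
    by apply: (a_free g); rewrite ?CS // -leg.
  rewrite c1N //; case: ee0 => ee0; first exact: a_free.
  by move=> cea; rewrite C_a in Ce.
have neq0 e : e \in S -> (e == e0) = false.
  by move=> eS; apply: contraNF e0S => /eqP <-.
exists (fun e => if e == e0 then a else c1 e); split.
  move=> e f /setU1P[->|eS] /setU1P[->|fS] // neq_ef ef; rewrite ?eqxx ?neq0 //.
  - by apply/nesym/c1_free => //; case: ef => ->; auto.
  - exact: c1_free.
  - exact: c1S.
by move=> e /setU1P[->|eS]; rewrite ?eqxx ?neq0 // c1_in.
Qed.

(** Induction on the number of edges: deleting [e0] leaves fewer than [n] edges at each of its ends,
    hence a missing colour at each, and [proper_extend] puts [e0] back. *)
Lemma konig_edge_coloring (S : {set K}) n :
  (forall e, e \in S -> #|[set f in S | l f == l e]| <= n) ->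
  (forall e, e \in S -> #|[set f in S | r f == r e]| <= n) ->
  exists c, proper_on c S /\ {in S, forall e, 0 < c e <= n}.
Proof.
have [m] := ubnP #|S|; elim: m S => // m IHm S ltSm lS rS.
have [->|[e0 e0S]] := set_0Vmem S.
  by exists (fun=> 0); split=> e => [f|]; rewrite inE.
have sub (p : pred K) : [set f in S :\ e0 | p f] \subset [set f in S | p f].
  by apply/subsetP => f; rewrite !inE => /andP[/andP[_ ->] ->].
have lt_sub (p : pred K) : p e0 -> #|[set f in S | p f]| <= n ->
    #|[set f in S :\ e0 | p f]| < n.
  move=> pe0; apply: leq_trans; apply: proper_card; apply/properP.
  by split=> //; exists e0; rewrite !inE ?eqxx ?e0S.
have [||| c [cS c_in]] := IHm (S :\ e0).
- by rewrite (cardsD1 e0) e0S in ltSm.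
- by move=> e /setD1P[_ eS]; apply/(leq_trans _ (lS e eS))/subset_leq_card/sub.
- by move=> e /setD1P[_ eS]; apply/(leq_trans _ (rS e eS))/subset_leq_card/sub.
have [a a_in a_free] :=
  missing_color c (lt_sub [pred f | l f == l e0] (eqxx _) (lS _ e0S)).
have [b b_in b_free] :=
  missing_color c (lt_sub [pred f | r f == r e0] (eqxx _) (rS _ e0S)).
rewrite -(setD1K e0S); apply: proper_extend cS c_in _ a_in _ b_in _.
- by rewrite !inE eqxx.
- by move=> e eS lee0; apply/eqP/a_free; rewrite inE eS /= lee0.
- by move=> e eS ree0; apply/eqP/b_free; rewrite inE eS /= ree0.
Qed.

End TwoSided.

(** * Bipartite multigraphs and the on-line game *)

Section Multigraphs.
Variables V K : finType.
Implicit Types (G : multigraph V K) (X : {set V}) (l r : K -> V).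

Definition two_sided G X l r :=
  {in edges G, forall e,
     [/\ ends G e = [set l e; r e], l e \in X & r e \notin X]}.

Lemma bipartition_two_sided G X :
  bipartition G X -> 0 < #|edges G| -> exists l r, two_sided G X l r.
Proof.
move=> bipX /card_gt0P[e0 e0G].
(* A vertex to serve as default value of [odflt]; on edges both picks succeed. *)
have /card_gt0P[v0 _] : 0 < #|ends G e0| by rewrite card_ends.
exists (fun e => odflt v0 [pick v in ends G e :&: X]).
exists (fun e => odflt v0 [pick v in ends G e :&: ~: X]) => e eG.
have [/eqP/cards1P[x xE] /eqP/cards1P[y yE]] := bipX e eG.
have /setIP[_ xX] : x \in ends G e :&: X by rewrite xE set11.
have /setIP[_] : y \in ends G e :&: ~: X by rewrite yE set11.
rewrite inE => yX; rewrite xE yE.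
case: pickP => [x' /set1P ->|/(_ x)]; last by rewrite set11.
case: pickP => [y' /set1P ->|/(_ y)]; last by rewrite set11.
by split=> //; rewrite -(setID (ends G e) X) xE setDE yE.
Qed.

Section TwoSidedGraph.
Variables (X : {set V}) (l r : K -> V).

Lemma ends_disjoint G e f : two_sided G X l r ->
  e \in edges G -> f \in edges G ->
  [disjoint ends G e & ends G f] = (l e != l f) && (r e != r f).
Proof.
move=> lrG /lrG[-> leX reX] /lrG[-> lfX rfX].
have lr x y : x \in X -> y \notin X -> (x == y) = false.
  by move=> xX yX; apply: contraNF yX => /eqP <-.
rewrite disjoints_subset subUset !sub1set !inE.
by rewrite (lr (l e) (r f)) // (eq_sym (r e) (l f)) (lr (l f) (r e)) // orbF.
Qed.

Lemma edge_coloring_two_sided G m c : two_sided G X l r ->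
  edge_coloring G m c <->
  {in edges G, forall e, 0 < c e <= m} /\ proper_on l r c (edges G).
Proof.
move=> lrG; split=> -[c_in cG]; split=> // e f eG fG neq_ef.
  by move=> ef; apply: cG; rewrite // (ends_disjoint lrG) //; case: ef => ->;
     rewrite eqxx ?andbF.
rewrite (ends_disjoint lrG) // => ef; apply: cG => //; move: ef.
by rewrite negb_and !negbK => /orP[]/eqP; auto.
Qed.

(* Every round in which an edge [e] survives lowers [t (l e) + t (r e)], if an
   end of [e] is in [U], or else the number of out-neighbours of [e], if the
   colour is given to a kernel. *)
Lemma online_colorable_out_nbrs c m t G :
  two_sided G X l r -> proper_on l r c (edges G) ->
  {in edges G, forall e,
     t (l e) + t (r e) + #|out_nbrs l r c (edges G) e| < m} ->
  online_colorable m t G.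
Proof.
elim: m t G => [|m IHm] t G lrG cG out_lt /=.
  by apply: eq_card0 => e; apply/negP => /out_lt.
move=> U /subsetP Usupp.
pose S := edges_del_vertices G U.
have SG : S \subset edges G by apply/subsetP => e; rewrite inE => /andP[].
have [F [/subsetP FU indepF absF]] := kernel_exists (proper_onS SG cG).
have FG e : e \in F -> e \in edges G by move/FU; apply: subsetP SG e.
exists F; split; first exact/subsetP.
  move=> e f eF fF /(indepF e f eF fF)[/eqP nl /eqP nr].
  by rewrite (ends_disjoint lrG) ?FG // nl nr.
apply: IHm => [e|e f|e].
- by rewrite inE => /andP[_ /lrG].
- by rewrite !inE => /andP[_ eG] /andP[_ fG]; apply: cG.
rewrite inE => /andP[eF eG]; rewrite -ltnS; apply: leq_trans (out_lt e eG).
have sub : out_nbrs l r c (edges (del_edges G F)) e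
    \subset out_nbrs l r c (edges G) e.
  exact/out_nbrsS/subsetDl.
have [eU|eU] := boolP (e \in S); last first.
  have lrU : (l e \in U) || (r e \in U).
    apply: contraR eU; rewrite negb_or => /andP[lU rU]; rewrite inE eG /=.
    have [-> _ _] := lrG e eG.
    by rewrite disjoints_subset subUset !sub1set !inE lU.
  (* As [U] lies in [supp t], the truncated subtraction really lowers [t v]. *)
  have t_lt v : v \in U -> t v - (v \in U) < t v.
    by move=> vU; have := Usupp v vU; rewrite inE -lt0n vU ltn_subrL => ->.
  rewrite ltnS -addSn leq_add ?subset_leq_card //.
  case/orP: lrU => /t_lt vU; first by rewrite -addSn leq_add ?leq_subr.
  by rewrite -addnS leq_add ?leq_subr.
rewrite ltnS -addnS leq_add ?leq_add ?leq_subr //.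
have [f fF fe] := absF e eU eF.
apply: proper_card; apply/properP; split=> //.
by exists f; [apply: subsetP fe; apply: out_nbrsS | rewrite !inE fF].
Qed.

End TwoSidedGraph.

(** The shift [k] counts the rounds already played: the answer [F] to the current round gets colour
    [k.+1], and the induction continues from there. The bound [k < c' e] keeps later colours
    distinct from this one. *)
Lemma online_colorable_prefixed m k t G (c : V -> set nat) :
  (forall v, count (fun j => `[< c v j >]) (iota k.+1 m) <= t v) ->
  online_colorable m t G ->
  exists c', [/\ edge_coloring G (k + m) c', {in edges G, forall e, k < c' e} &
                 avoids G c c'].
Proof.
elim: m k t G => [|m IHm] k t G c_le /=.
  move/eqP; rewrite cards_eq0 => /eqP G0.
  by exists (fun=> 0); split; [split=> e|move=> e|move=> e]; rewrite G0 inE.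
pose U := [set v | `[< c v k.+1 >]].
have c_le1 v : (v \in U) + count (fun j => `[< c v j >]) (iota k.+2 m) <= t v.
  by have := c_le v; rewrite inE.
have Usupp : U \subset supp t.
  apply/subsetP => v vU; have := c_le1 v.
  by rewrite vU inE -lt0n; apply: leq_trans.
move=> /(_ U Usupp)[F [/subsetP FU indepF /(IHm k.+1)[]]].
  move=> v; rewrite leq_subRL ?c_le1 //.
  by apply: leq_trans (c_le1 v); rewrite leq_addr.
rewrite addSnnS => c1 [[c1_in c1_proper] c1_gt c1_avoids].
have del e : e \in edges G -> e \notin F -> e \in edges (del_edges G F).
  by move=> eG eF; rewrite inE eF.
exists (fun e => if e \in F then k.+1 else c1 e); split.
- split=> [e eG|e f eG fG neq_ef touch].
    by case: ifPn => eF; [rewrite ltn0Sn addnS ltnS leq_addr | apply/c1_in/del].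
  case: ifPn => eF; case: ifPn => fF.
  + by rewrite (indepF e f) in touch.
  + by apply/eqP; rewrite ltn_eqF // c1_gt ?del.
  + by apply/eqP; rewrite gtn_eqF // c1_gt ?del.
  + by apply: c1_proper; rewrite ?del.
- by move=> e eG; case: ifPn => eF //; apply/ltnW/c1_gt/del.
- move=> e eG; case: ifPn => eF; last by apply/c1_avoids/del.
  move=> [v ve cv]; have := FU e eF; rewrite inE => /andP[_ /pred0P/(_ v)].
  by rewrite /= inE asboolT // andbT => /negP; apply.
Qed.

(** Edges at [v] meet pairwise, so their colours differ. The lower bounds use [p = 0] for the
    chromatic index and [p = t1 + t2] for the labeling [c0]. *)
Lemma degree_le_colors G v p n c' :
  {in edges G, forall e, p < c' e <= p + n} ->
  (forall e f, e \in edges G -> f \in edges G -> e <> f ->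
     ~~ [disjoint ends G e & ends G f] -> c' e <> c' f) ->
  degree G v <= n.
Proof.
move=> c_in c_proper; apply: (@card_colors _ _ c' p) => [e f|e]; last first.
  by rewrite inE => /andP[/c_in].
rewrite !inE => /andP[eG ve] /andP[fG vf] ceq; apply: contrapT => neq_ef.
by apply: (c_proper e f) => //; apply/pred0Pn; exists v; rewrite /= ve.
Qed.

End Multigraphs.

(** * Upper and lower bounds combined *)

Theorem corollary3p6 (V K : finType) (B : multigraph V K) (X : {set V})
    (t : V -> nat) (t1 t2 : nat) :
  bipartition B X ->
  0 < #|edges B| ->
  (forall v, v \in X -> t v = t1) ->
  (forall v, v \notin X -> t v = t2) ->
  online_t_avoiding_index B t = t_avoiding_index B t /\
  t_avoiding_index B t = chromatic_index B + t1 + t2 /\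
  chromatic_index B + t1 + t2 = max_degree B + t1 + t2.
Proof.
move=> bipX B_gt0 tX tNX.
have [l [r lrB]] := bipartition_two_sided bipX B_gt0.
have [e0 e0B] := card_gt0P B_gt0.
pose D := max_degree B.
have degD v : degree B v <= D by apply: leq_bigmax.
have [|v0 degv0] := @eq_bigmax V (degree B).
  by apply/card_gt0P; exists (l e0).
have D_gt0 : 0 < D.
  apply: leq_trans (degD (l e0)); apply/card_gt0P; exists e0.
  by have [endsE _ _] := lrB e0 e0B; rewrite inE e0B endsE set21.
have l_le e : #|[set f in edges B | l f == l e]| <= D.
  apply: leq_trans (degD (l e)); apply/subset_leq_card/subsetP => f.
  rewrite !inE => /andP[fB /eqP <-].
  by have [-> _ _] := lrB f fB; rewrite fB set21.
have r_le e : #|[set f in edges B | r f == r e]| <= D.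
  apply: leq_trans (degD (r e)); apply/subset_leq_card/subsetP => f.
  rewrite !inE => /andP[fB /eqP <-].
  by have [-> _ _] := lrB f fB; rewrite fB set22.
have [c [c_proper c_in]] :=
  konig_edge_coloring (fun e _ => l_le e) (fun e _ => r_le e).
have chiD : chromatic_index B = D.
  apply: nat_minP => [|m [_ [c' [c'_in c'_proper]]]].
    by split=> //; exists c; apply/(edge_coloring_two_sided _ _ lrB).
  rewrite /D /max_degree degv0.
  exact: (@degree_le_colors _ _ _ _ 0 m c' c'_in).
(* For each edge the values of [t] at its ends add up to [t1 + t2], and it has fewer than [D]
   out-neighbours. *)
have online : online_colorable (D + t1 + t2) t B.
  apply: (@online_colorable_out_nbrs _ _ X l r c) => // e eB.
  have [_ leX reX] := lrB e eB.
  rewrite (tX _ leX) (tNX _ reX) -[ltnRHS]addnA [ltnRHS]addnC ltn_add2l.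
  exact: card_out_nbrs.
pose c0 v := if v \in X then [set k | 0 < k <= t1]%classic
             else [set k | t1 < k <= t1 + t2]%classic.
have c0_label : t_labeling t c0.
  have card_itv p n : ([set k | (p < k <= p + n)%N] #<= `I_n)%card.
    apply: card_le_trans (card_image_le (addn p.+1) _).
    apply: subset_card_le => k /andP[ltpk lekpn].
    by exists (k - p.+1); rewrite /= ?subnKC // ltn_subLR.
  split=> v; rewrite /c0; case: ifPn => vX.
  - by move=> k /= /andP[].
  - by move=> k /= /andP[+ _]; apply: leq_trans.
  - by rewrite tX //; apply: (card_itv 0).
  - by rewrite tNX.
have c0_lower m c' : edge_coloring B m c' -> avoids B c0 c' -> D + t1 + t2 <= m.
  move=> [c'_in c'_proper] c'_avoids.
  have c'_gt e : e \in edges B -> t1 + t2 < c' e.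
    move=> eB; have [endsE leX reX] := lrB e eB.
    rewrite ltnNge; apply/negP => le_c'; apply: (c'_avoids e eB).
    have [c'_gt0 _] := andP (c'_in e eB).
    have [le1|gt1] := leqP (c' e) t1.
      by exists (l e); rewrite /= ?endsE ?set21 // /c0 leX /= c'_gt0.
    by exists (r e); rewrite /= ?endsE ?set22 // /c0 (negbTE reX) /= gt1.
  (* The colour of [e0] already exceeds [t1 + t2], so the subtraction [m - (t1 + t2)] below is not
     truncated. *)
  have le_m : t1 + t2 <= m.
    by have /andP[_] := c'_in e0 e0B; apply/leq_trans/ltnW/c'_gt.
  rewrite -addnA addnC -leq_subRL // /D /max_degree degv0.
  apply: (@degree_le_colors _ _ _ _ (t1 + t2)) c'_proper => e eB.
  rewrite c'_gt // subnKC //.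
  by have /andP[] := c'_in e eB.
have prefixed s : t_labeling t s ->
    exists c', edge_coloring B (D + t1 + t2) c' /\ avoids B s c'.
  move=> [_ s_card].
  have [|c' [? _ ?]] := @online_colorable_prefixed _ _ _ 0 _ _ s _ online.
    by move=> v; apply: card_le_count (s_card v) (iota_uniq _ _).
  by exists c'.
have M_gt0 : 0 < D + t1 + t2 by rewrite !addn_gt0 D_gt0.
(* The labeling [c0] attains the maximum, and [prefixed] bounds the index of every other one. *)
have chi_tD : t_avoiding_index B t = D + t1 + t2.
  apply: nat_maxP => [|_ [s /prefixed s_col <-]]; last by apply: nat_min_le.
  exists c0 => //; apply: nat_minP => [|m [_ [c' []]]].
    by split=> //; apply: prefixed.
  exact: c0_lower.
rewrite chi_tD chiD; split=> //; apply: nat_minP => // m online_m.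
(* Played against [c0], an on-line strategy with [m] rounds yields a colouring to which [c0_lower]
   applies. *)
have [|c' [c'_col _ c'_avoids]] :=
  @online_colorable_prefixed _ _ _ 0 _ _ c0 _ online_m.
  by move=> v; apply: card_le_count (c0_label.2 v) (iota_uniq _ _).
exact: c0_lower c'_col c'_avoids.
Qed.
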